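(* Let $f:P^+\to\mathbb{R}_+$ be the control objective function of the stochastic power system described in the context. There exists $p_s^*\in P^+$ such that $f(p_s^* )=\inf_{p_s\in P^+} f(p_s)$.
   Context: $\mathbb{R}_+$ denotes the nonnegative reals, $\mathbb{Z}_n=\{1,\dots,n\}$, $A(k)$ is the $k$-th row of the matrix $A$, and $e_i$ is the $i$-th unit vector. Network data: a connected graph $G=(V,E)$ with $n_V$ vertices and $n_E$ edges and incidence matrix $B\in\mathbb{R}^{n_V\times n_E}$ (for the $k$-th edge $(i_k,j_k)$ the $k$-th column has $+1$ in row $i_k$, $-1$ in row $j_k$, zeros elsewhere); diagonal matrices $M\in\mathbb{R}^{n_V\times n_V}$ (strictly positive diagonal), $D\in\mathbb{R}^{n_V\times n_V}$ (nonnegative diagonal), $K_2\in\mathbb{R}^{n_V\times n_V}$ (nonnegative diagonal), $W\in\mathbb{R}^{n_E\times n_E}$ (strictly positive diagonal). Vertices $1,\dots,n^+$ ($n^+\ge 2$) are power supply nodes, vertices $n^++1,\dots,n_V$ are demand nodes. Given are $p^{+,max}\in\mathbb{R}_+^{n^+}$, $p^-\in\mathbb{R}_+^{n_V-n^+}$ with $p^-_{sum}=\sum_i p_i^->0$ and $\sum_{i=1}^{n^+}p_i^{+,max}\ge p^-_{sum}$, and a parameter $r>0$. Domain: $P^+=\{p_s\in\mathbb{R}_+^{n^+-1} : b_1\le A_1p_s,\ p_s\le b_2\}$ (componentwise), where $b_1(i)=p_{sum}^--p_{n^+}^{+,max}-\cdots-p_{i+1}^{+,max}$, $b_2(i)=p_i^{+,max}$,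 and $A_1\in\mathbb{R}^{(n^+-1)\times(n^+-1)}$ has $A_1(i,j)=1$ if $i\ge j$ and $0$ otherwise. Let $L=BWB^\top$ with Moore–Penrose inverse $L^\dagger$, $A=B^\top L^\dagger[e_1-e_{n^+},\dots,e_{n^+-1}-e_{n^+}]\in\mathbb{R}^{n_E\times(n^+-1)}$, $b=B^\top L^\dagger[e_{n^++1}-e_{n^+},\dots,e_{n_V}-e_{n^+}](-p^-)\in\mathbb{R}^{n_E}$. Standing assumption: $|A(k)p_s+b_k|<1$ for all $p_s\in P^+$, $k\in\mathbb{Z}_{n_E}$. Set $f_{as,k}(p_s)=\arcsin(|A(k)p_s+b_k|)$. Standard deviations: let $W(p_s)=W\,\mathrm{diag}(\cos(\arcsin(Ap_s+b)))$ and let $U(p_s)\in\mathbb{R}^{n_V\times n_V}$ be orthogonal such that $U(p_s)^\top M^{-1/2}BW(p_s)B^\top M^{-1/2}U(p_s)$ is diagonal with first diagonal entry $0$. For a matrix $X$ with $n_V$ columns let $X([2:n_V])$ be the matrix of its columns $2,\dots,n_V$. Put (writing $U=U(p_s)$) $$J_d(p_s)=\begin{bmatrix}0_{(n_V-1)\times(n_V-1)} & [\,0_{(n_V-1)\times1}\ \ I_{n_V-1}\,]\\ -(U^\top M^{-1/2}BW(p_s)B^\top M^{-1/2}U)([2:n_V]) & -U^\top M^{-1}DU\end{bmatrix},$$ $$K_d(p_s)=\begin{bmatrix}0_{(n_V-1)\times n_V}\\ U^\top M^{-1/2}K_2\end{bmatrix},\quad C_d(p_s)=[\,(B^\top M^{-1/2}U)([2:n_V])\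 \ 0_{n_E\times n_V}\,].$$ Standing assumption: $J_d(p_s)$ is Hurwitz for all $p_s\in P^+$. Let $Q(p_s)$ be the unique solution of $J_dQ+QJ_d^\top+K_dK_d^\top=0$ and $\sigma_k(p_s)=\big((C_dQC_d^\top)(k,k)\big)^{1/2}$, assumed strictly positive on $P^+$. Control objective function: $f_k(p_s)=f_{as,k}(p_s)+r\,\sigma_k(p_s)$ and $f(p_s)=\max_{k\in\mathbb{Z}_{n_E}}f_k(p_s)$. *)

(* Defs.v *)
From HB Require Import structures.
From mathcomp Require Import all_boot all_order all_algebra.
From mathcomp Require Import complex.
From mathcomp Require Import all_classical all_reals all_analysis.
Set Implicit Arguments.
Unset Strict Implicit.
Unset Printing Implicit Defensive.
Import Order.TTheory GRing.Theory Num.Theory.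
Local Open Scope classical_set_scope.
Local Open Scope ring_scope.

Section Matrices.
Variable R : realType.

Definition moore_penrose m n (X : 'M[R]_(m, n)) (Y : 'M[R]_(n, m)) : Prop :=
  [/\ X *m Y *m X = X, Y *m X *m Y = Y,
      (X *m Y)^T = X *m Y & (Y *m X)^T = Y *m X].

Definition mp_inv m n (X : 'M[R]_(m, n)) : 'M[R]_(n, m) :=
  xget 0 [set Y : 'M[R]_(n, m) | moore_penrose X Y].

Definition hurwitz n (J : 'M[R]_n) : Prop :=
  forall z : R[i], eigenvalue (map_mx (real_complex R) J) z ->
    complex.Re z < 0.

(* The solution Q of J Q + Q J^T + K K^T = 0; it is unique as soon as J is
   Hurwitz, which is the only case of interest. *)
Definition lyapunov_sol n m (J : 'M[R]_n) (K : 'M[R]_(n, m)) : 'M[R]_n :=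
  xget 0 [set Q : 'M[R]_n | J *m Q + Q *m J^T + K *m K^T = 0].

(* X^{-1/2} for X = diag_mx x with x entrywise positive. *)
Definition diag_invsqrt n (x : 'rV[R]_n) : 'M[R]_n :=
  diag_mx (\row_i (Num.sqrt (x 0 i))^-1).

End Matrices.

(* Here n^+ = ns.+1, the number of demand nodes is nd, n_V = (ns + nd).+1 and
   indices start from 0: the supply nodes are the vertices 0, ..., ns, the node
   n^+ of the mathematical text being vertex ns, and the demand nodes are the
   vertices ns + 1, ..., ns + nd.  The k-th edge is (src k, dst k), and the
   diagonal matrices M, D, K_2, W are given by their diagonals. *)
Record network (R : realType) (ns nd nE : nat) := Network {
  src : 'I_nE -> 'I_(ns + nd).+1;
  dst : 'I_nE -> 'I_(ns + nd).+1;
  diagM : 'rV[R]_(ns + nd).+1;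
  diagD : 'rV[R]_(ns + nd).+1;
  diagK2 : 'rV[R]_(ns + nd).+1;
  diagW : 'rV[R]_nE;
  pmax : 'cV[R]_ns.+1;
  pdem : 'cV[R]_nd
}.

Section Network.
Variables (R : realType) (ns nd nE : nat) (N : network R ns nd nE).

Local Notation n := (ns + nd)%N.
Local Notation nV := (ns + nd).+1.

Definition simple_graph : Prop :=
  (forall k, src N k != dst N k) /\
  injective (fun k => [set src N k; dst N k]%SET).

Definition adjacent : rel 'I_nV := fun x y =>
  [exists k, ((src N k == x) && (dst N k == y))
          || ((src N k == y) && (dst N k == x))].

Definition connected_graph : Prop := forall x y, connect adjacent x y.

Definition incidence : 'M[R]_(nV, nE) :=
  \matrix_(i, k) (if i == src N k then 1 else if i == dst N k then -1 else 0).

Definition psum : R := \sum_j pdem N j 0.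

(* The ns supply nodes other than the slack node n^+. *)
Definition free_supply (i : 'I_ns) : 'I_ns.+1 := widen_ord (leqnSn ns) i.

Definition supply_vertex (i : 'I_ns.+1) : 'I_nV := lshift nd i.
Definition demand_vertex (j : 'I_nd) : 'I_nV := rshift ns.+1 j.

Definition A1 : 'M[R]_ns := \matrix_(i, j) ((j <= i)%N)%:R.
Definition b1 : 'cV[R]_ns :=
  \col_i (psum - \sum_(j < ns.+1 | (i < j)%N) pmax N j 0).
Definition b2 : 'cV[R]_ns := \col_i pmax N (free_supply i) 0.

Definition Pplus : set 'cV[R]_ns :=
  [set p : 'cV[R]_ns | [/\ forall i, 0 <= p i 0,
               forall i, b1 i 0 <= (A1 *m p) i 0
             & forall i, p i 0 <= b2 i 0]].

Definition laplacian : 'M[R]_nV :=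
  incidence *m diag_mx (diagW N) *m incidence^T.

Definition unit_vec (v : 'I_nV) : 'cV[R]_nV := delta_mx v 0.

Definition slack_vec : 'cV[R]_nV := unit_vec (supply_vertex ord_max).

Definition supply_dirs : 'M[R]_(nV, ns) :=
  \matrix_(v, i) (unit_vec (supply_vertex (free_supply i)) - slack_vec) v 0.
Definition demand_dirs : 'M[R]_(nV, nd) :=
  \matrix_(v, j) (unit_vec (demand_vertex j) - slack_vec) v 0.

Definition flowA : 'M[R]_(nE, ns) :=
  incidence^T *m mp_inv laplacian *m supply_dirs.
Definition flowb : 'cV[R]_nE :=
  incidence^T *m mp_inv laplacian *m demand_dirs *m (- pdem N).

Definition flow (p : 'cV[R]_ns) (k : 'I_nE) : R := (flowA *m p + flowb) k 0.

Definition f_as (k : 'I_nE) (p : 'cV[R]_ns) : R := asin `|flow p k|.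

Definition Wmx (p : 'cV[R]_ns) : 'M[R]_nE :=
  diag_mx (diagW N) *m diag_mx (\row_k cos (asin (flow p k))).

Definition Mmx : 'M[R]_nV := diag_mx (diagM N).
Definition Misqrt : 'M[R]_nV := diag_invsqrt (diagM N).

(* M^{-1/2} B W(p) B^T M^{-1/2} *)
Definition scaled_laplacian (p : 'cV[R]_ns) : 'M[R]_nV :=
  Misqrt *m incidence *m Wmx p *m incidence^T *m Misqrt.

Definition diagonalizes (V : 'M[R]_nV) (p : 'cV[R]_ns) : Prop :=
  [/\ V^T *m V = 1%:M :> 'M[R]_nV,
      is_diag_mx (V^T *m scaled_laplacian p *m V)
    & (V^T *m scaled_laplacian p *m V) ord0 ord0 = 0].

Variable U : 'cV[R]_ns -> 'M[R]_nV.

(* [col' ord0 X] is the matrix X([2:n_V]) of the columns of X but the first. *)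
Definition Jd (p : 'cV[R]_ns) : 'M[R]_(n + nV) :=
  block_mx
    (0 : 'M[R]_(n, n))
    (row_mx (0 : 'M[R]_(n, 1)) (1%:M : 'M[R]_n))
    (- col' ord0 ((U p)^T *m scaled_laplacian p *m U p))
    (- ((U p)^T *m invmx Mmx *m diag_mx (diagD N) *m U p)).

Definition Kd (p : 'cV[R]_ns) : 'M[R]_(n + nV, nV) :=
  col_mx (0 : 'M[R]_(n, nV)) ((U p)^T *m Misqrt *m diag_mx (diagK2 N)).

Definition Cd (p : 'cV[R]_ns) : 'M[R]_(nE, n + nV) :=
  row_mx (col' ord0 (incidence^T *m Misqrt *m U p)) (0 : 'M[R]_(nE, nV)).

Definition sigma (k : 'I_nE) (p : 'cV[R]_ns) : R :=
  Num.sqrt ((Cd p *m lyapunov_sol (Jd p) (Kd p) *m (Cd p)^T) k k).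

Definition f_line (r : R) (k : 'I_nE) (p : 'cV[R]_ns) : R :=
  f_as k p + r * sigma k p.

(* The terms are nonnegative on the domain and, the graph being connected with
   at least two vertices, there is at least one: the default value 0 does not
   alter the maximum. *)
Definition f_obj (r : R) (p : 'cV[R]_ns) : R :=
  \big[Num.max/0]_(k < nE) f_line r k p.

End Network.

(* Main.v *)
(* The domain is a nonempty compact polytope (it contains p = p^max), so it is
   enough that f be continuous on it.  The only difficulty is sigma_k, because
   the diagonalizing matrix U(p) need not depend continuously on p.

   The weights of W(p) are positive and the graph is connected, so the kernel of
   M^{-1/2} B W(p) B^T M^{-1/2} is the line spanned by M^{1/2} 1, whatever p is.
   Hence the first columns of all the U(p) agree up to sign, and for a fixed
   V = U(p_0) the orthogonal matrix V^T U(p) is block diagonal diag(+-1, Z').  The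
   change of state variables diag(Z', V^T U(p)) then shows that sigma_k does not
   change when U(p) is replaced by the constant V.  With V in place of U, the
   matrix J_d is continuous in p, K_d and C_d are constant, and by Cramer's rule
   the solution of the Lyapunov equation is a continuous function of J_d as long
   as J_d is Hurwitz. *)

Require Import Defs.
From HB Require Import structures.
From mathcomp Require Import all_boot all_order all_algebra.
From mathcomp Require Import complex.
From mathcomp Require Import all_classical all_reals all_analysis.
Import Order.TTheory GRing.Theory Num.Theory.
Import numFieldNormedType.Exports.
Local Open Scope classical_set_scope.
Local Open Scope ring_scope.

(** * The Lyapunov equation *)

Lemma horner_mx_intertwine {R : comNzRingType} {m n : nat}
    (A : 'M[R]_m.+1) (B : 'M[R]_n.+1) (X : 'M[R]_(m.+1, n.+1)) (p : {poly R}) :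
  A *m X = X *m B -> horner_mx A p *m X = X *m horner_mx B p.
Proof.
move=> AXB; elim/poly_ind: p => [|p c IH].
  by rewrite !rmorph0 mul0mx mulmx0.
rewrite !rmorphD !rmorphM /= !horner_mx_X !horner_mx_C -!mulmxE.
by rewrite mulmxDl mulmxDr -mulmxA AXB !mulmxA IH scalar_mxC.
Qed.

Lemma eigenvalue_unitmx {F : fieldType} {n : nat} (A : 'M[F]_n) (a : F) :
  eigenvalue A a = (A - a%:M \notin unitmx).
Proof. by rewrite /eigenvalue /eigenspace kermx_eq0 row_free_unit. Qed.

Lemma eigenvalueN_tr {F : fieldType} {n : nat} (A : 'M[F]_n) (a : F) :
  eigenvalue (- A^T) a = eigenvalue A (- a).
Proof.
have E : - A^T - a%:M = (-1) *: (A - (- a)%:M)^T.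
  by apply/matrixP => i j; rewrite !mxE mulN1r opprB addrC mulNrn eq_sym.
by rewrite !eigenvalue_unitmx E unitmxZ ?unitrN1 // unitmx_tr.
Qed.

(* Cayley-Hamilton gives X *m chi_A(B) = 0, and chi_A(B) is a product of the
   invertible matrices B - a%:M for a an eigenvalue of A. *)
Lemma sylvester_eq0 {F : closedFieldType} {m n : nat}
    (A : 'M[F]_m) (B : 'M[F]_n) (X : 'M[F]_(m, n)) :
  (forall a, eigenvalue A a -> ~~ eigenvalue B a) -> A *m X = X *m B -> X = 0.
Proof.
case: m A X => [A X _ _|m A X]; first exact: flatmx0.
case: n B X => [B X _ _|n B X AB]; first exact: thinmx0.
move/(horner_mx_intertwine A B X (char_poly A)).
rewrite Cayley_Hamilton mul0mx => /esym XB0.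
suff uB : horner_mx B (char_poly A) \in unitmx.
  by rewrite -(mulmxK uB X) XB0 mul0mx.
have [s Es] := closed_field_poly_normal (char_poly A).
rewrite (monicP (char_poly_monic A)) scale1r in Es.
rewrite Es rmorph_prod /=; apply: unitr_prod_in => z zs _.
rewrite rmorphB /= horner_mx_X horner_mx_C -[_ \is a _]negbK.
rewrite -[X in ~~ X]eigenvalue_unitmx AB // eigenvalue_root_char Es.
by rewrite root_prod_XsubC.
Qed.

(** This is the Sylvester equation [J *m X = X *m (- J^T)]. A common eigenvalue [a] of [J] and
    [- J^T] would make both [a] and [- a] eigenvalues of [J], and their real parts cannot both be
    negative. *)
Lemma hurwitz_lyapunov_eq0 {R : realType} {n : nat} (J X : 'M[R]_n) :
  hurwitz J -> J *m X + X *m J^T = 0 -> X = 0.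
Proof.
move=> hJ /eqP; rewrite addr_eq0 => /eqP JX.
pose c := real_complex R.
apply/eqP; rewrite -(map_mx_eq0 c); apply/eqP.
apply: (sylvester_eq0 (map_mx c J) (map_mx c (- J^T))); last first.
  by rewrite -!map_mxM JX mulmxN.
move=> a ea; apply/negP => eNa.
have eNa' : eigenvalue (map_mx c J) (- a).
  by rewrite -eigenvalueN_tr map_trmx -map_mxN.
have := hJ _ ea; have := hJ _ eNa'.
by case: a {ea eNa eNa'} => x y /=; rewrite oppr_lt0 => /ltW; rewrite leNgt => /negP.
Qed.

(** Eigenvectors are row vectors: if [v] is one for [J'], then [v *m T] is one for [J] with the same
    eigenvalue. *)
Lemma hurwitz_intertwine {R : realType} {n : nat} (J J' T : 'M[R]_n) :
  T \in unitmx -> J' *m T = T *m J -> hurwitz J -> hurwitz J'.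
Proof.
move=> uT JT hJ z ez; apply: hJ; move: ez.
pose c := real_complex R.
move=> /eigenvalueP [v vJ v0]; apply/eigenvalueP; exists (v *m map_mx c T).
  by rewrite -mulmxA -map_mxM -JT map_mxM mulmxA vJ -scalemxAl.
apply: contra_neq v0 => vT0.
have ucT : map_mx c T \in unitmx by rewrite map_unitmx.
by rewrite -(mulmxK ucT v) vT0 mul0mx.
Qed.

(** Packaged as a linear map, so that [lin_mx] turns the Lyapunov equation into a square linear
    system on vectorized matrices. *)
Definition lyapunov_op {R : realType} {n : nat} (J X : 'M[R]_n) : 'M[R]_n :=
  J *m X + X *m J^T.

Lemma lyapunov_op_is_linear {R : realType} {n : nat} (J : 'M[R]_n) :
  linear (lyapunov_op J).
Proof.
move=> a X Y; rewrite /lyapunov_op mulmxDr mulmxDl scalerDr -scalemxAr -scalemxAl.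
by rewrite addrACA.
Qed.

HB.instance Definition _ (R : realType) (n : nat) (J : 'M[R]_n) :=
  GRing.isLinear.Build R 'M[R]_n 'M[R]_n _ (lyapunov_op J)
    (lyapunov_op_is_linear J).

Lemma lyapunov_op_unitmx {R : realType} {n : nat} (J : 'M[R]_n) :
  hurwitz J -> lin_mx (lyapunov_op J) \in unitmx.
Proof.
move=> hJ; rewrite -row_free_unit -kermx_eq0; apply/rowV0P => v /sub_kermxP.
rewrite mul_rV_lin -[0 in RHS](linear0 mxvec) => /(can_inj mxvecK) v0.
by rewrite -[v]vec_mxK (hurwitz_lyapunov_eq0 J (vec_mx v)) ?linear0.
Qed.

(** The difference of two solutions solves the homogeneous equation, so the choice made by [xget] is
    forced. *)
Lemma lyapunov_solP {R : realType} {n m : nat} (J Q : 'M[R]_n) (K : 'M[R]_(n, m)) :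
  hurwitz J -> J *m Q + Q *m J^T + K *m K^T = 0 -> lyapunov_sol J K = Q.
Proof.
move=> hJ JQ; rewrite /lyapunov_sol; case: xgetP => [Y _ /= JY|/(_ Q)/(_ JQ)//].
apply/eqP; rewrite -subr_eq0; apply/eqP; apply: (hurwitz_lyapunov_eq0 J) => //.
rewrite mulmxBr mulmxBl addrACA -opprD; apply/eqP.
by rewrite subr_eq0 -(inj_eq (addIr (K *m K^T))) JY JQ.
Qed.

Lemma lyapunov_solE {R : realType} {n m : nat} (J : 'M[R]_n) (K : 'M[R]_(n, m)) :
  hurwitz J ->
  lyapunov_sol J K = vec_mx (mxvec (- (K *m K^T)) *m invmx (lin_mx (lyapunov_op J))).
Proof.
move=> hJ; apply: lyapunov_solP => //; set Q := vec_mx _.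
suff -> : J *m Q + Q *m J^T = - (K *m K^T) by rewrite addNr.
rewrite -[LHS]/(lyapunov_op J Q) -mx_rV_lin mulmxKV ?mxvecK //.
exact: lyapunov_op_unitmx.
Qed.

Lemma lyapunov_sol_eq {R : realType} {n m : nat} (J : 'M[R]_n) (K : 'M[R]_(n, m)) :
  hurwitz J -> lyapunov_op J (lyapunov_sol J K) = - (K *m K^T).
Proof.
move=> hJ; rewrite lyapunov_solE // -mx_rV_lin mulmxKV ?mxvecK //.
exact: lyapunov_op_unitmx.
Qed.

(** An orthogonal change of state coordinates: the conjugated solution satisfies the new equation,
    and uniqueness concludes. *)
Lemma lyapunov_sol_conj {R : realType} {n m : nat} (J J' T : 'M[R]_n)
    (K K' : 'M[R]_(n, m)) :
  T *m T^T = 1%:M -> J' *m T = T *m J -> K' = T *m K -> hurwitz J ->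
  lyapunov_sol J' K' = T *m lyapunov_sol J K *m T^T.
Proof.
move=> TT JT KT hJ; have [uT _] := mulmx1_unit TT.
apply: lyapunov_solP; first exact: hurwitz_intertwine uT JT hJ.
set Q := lyapunov_sol J K.
have -> : J' *m (T *m Q *m T^T) = T *m (J *m Q) *m T^T by rewrite !mulmxA JT.
have -> : T *m Q *m T^T *m J'^T = T *m (Q *m J^T) *m T^T.
  by rewrite -!mulmxA -trmx_mul JT trmx_mul.
rewrite -mulmxDl -mulmxDr -[J *m Q + _]/(lyapunov_op J Q) lyapunov_sol_eq //.
by rewrite KT trmx_mul mulmxN mulNmx !mulmxA addNr.
Qed.

(** * Entrywise limits of matrices *)

(** Entrywise and along any filter: matrix operations reduce to real sums and products, and limits
    within the domain are covered. *)
Definition mxcvg {R : realType} {T : Type} {m n : nat} (F : set_system T)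
    (A : T -> 'M[R]_(m, n)) (L : 'M[R]_(m, n)) : Prop :=
  forall i j, A t i j @[t --> F] --> L i j.

Section MatrixLimits.
Context {R : realType} {T : Type} (F : set_system T) {FF : Filter F}.

Lemma mxcvg_cst {m n : nat} (A : 'M[R]_(m, n)) : mxcvg F (fun=> A) A.
Proof. by move=> i j; exact: cvg_cst. Qed.

Lemma mxcvgD {m n : nat} {A B : T -> 'M[R]_(m, n)} {a b : 'M[R]_(m, n)} :
  mxcvg F A a -> mxcvg F B b -> mxcvg F (fun t => A t + B t) (a + b).
Proof.
by move=> Aa Bb i j; rewrite mxE; under eq_cvg do rewrite mxE; exact: cvgD.
Qed.

Lemma mxcvgN {m n : nat} {A : T -> 'M[R]_(m, n)} {a : 'M[R]_(m, n)} :
  mxcvg F A a -> mxcvg F (fun t => - A t) (- a).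
Proof.
by move=> Aa i j; rewrite mxE; under eq_cvg do rewrite mxE; exact: cvgN.
Qed.

Lemma mxcvgZ {m n : nat} {c : T -> R} {A : T -> 'M[R]_(m, n)} {l : R}
    {a : 'M[R]_(m, n)} :
  c @ F --> l -> mxcvg F A a -> mxcvg F (fun t => c t *: A t) (l *: a).
Proof.
by move=> cl Aa i j; rewrite mxE; under eq_cvg do rewrite mxE; exact: cvgM.
Qed.

Lemma mxcvgM {m n p : nat} {A : T -> 'M[R]_(m, n)} {B : T -> 'M[R]_(n, p)}
    {a : 'M[R]_(m, n)} {b : 'M[R]_(n, p)} :
  mxcvg F A a -> mxcvg F B b -> mxcvg F (fun t => A t *m B t) (a *m b).
Proof.
move=> Aa Bb i j; rewrite mxE; under eq_cvg do rewrite mxE.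
by apply: cvg_big => [|k _]; [exact: add_continuous | exact: cvgM].
Qed.

Lemma mxcvg_tr {m n : nat} {A : T -> 'M[R]_(m, n)} {a : 'M[R]_(m, n)} :
  mxcvg F A a -> mxcvg F (fun t => (A t)^T) a^T.
Proof. by move=> Aa i j; rewrite mxE; under eq_cvg do rewrite mxE; exact: Aa. Qed.

Lemma mxcvg_mxsub {m n m' n' : nat} (f : 'I_m' -> 'I_m) (g : 'I_n' -> 'I_n)
    {A : T -> 'M[R]_(m, n)} {a : 'M[R]_(m, n)} :
  mxcvg F A a -> mxcvg F (fun t => mxsub f g (A t)) (mxsub f g a).
Proof. by move=> Aa i j; rewrite mxE; under eq_cvg do rewrite mxE; exact: Aa. Qed.

Lemma mxcvg_block {m1 m2 n1 n2 : nat} {A : T -> 'M[R]_(m1, n1)}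
    {B : T -> 'M[R]_(m1, n2)} {C : T -> 'M[R]_(m2, n1)} {D : T -> 'M[R]_(m2, n2)}
    {a : 'M[R]_(m1, n1)} {b : 'M[R]_(m1, n2)} {c : 'M[R]_(m2, n1)}
    {d : 'M[R]_(m2, n2)} :
  mxcvg F A a -> mxcvg F B b -> mxcvg F C c -> mxcvg F D d ->
  mxcvg F (fun t => block_mx (A t) (B t) (C t) (D t)) (block_mx a b c d).
Proof.
move=> Aa Bb Cc Dd i j.
have [k ->|k ->] := split_ordP i; have [l ->|l ->] := split_ordP j.
- by rewrite block_mxEul; under eq_cvg do rewrite block_mxEul; exact: Aa.
- by rewrite block_mxEur; under eq_cvg do rewrite block_mxEur; exact: Bb.
- by rewrite block_mxEdl; under eq_cvg do rewrite block_mxEdl; exact: Cc.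
- by rewrite block_mxEdr; under eq_cvg do rewrite block_mxEdr; exact: Dd.
Qed.

Lemma mxcvg_diag_mx {n : nat} {A : T -> 'rV[R]_n} {a : 'rV[R]_n} :
  mxcvg F A a -> mxcvg F (fun t => diag_mx (A t)) (diag_mx a).
Proof.
move=> Aa i j; rewrite mxE; under eq_cvg do rewrite mxE.
by case: (i == j) => /=; [exact: Aa | exact: cvg_cst].
Qed.

Lemma cvg_det {n : nat} {A : T -> 'M[R]_n} {a : 'M[R]_n} :
  mxcvg F A a -> \det (A t) @[t --> F] --> \det a.
Proof.
move=> Aa; apply: cvg_big => [|s _]; first exact: add_continuous.
apply: cvgM; first exact: cvg_cst.
by apply: cvg_big => [|i _]; [exact: mul_continuous | exact: Aa].
Qed.

Lemma mxcvg_adj {n : nat} {A : T -> 'M[R]_n} {a : 'M[R]_n} :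
  mxcvg F A a -> mxcvg F (fun t => \adj (A t)) (\adj a).
Proof.
move=> Aa i j; rewrite mxE; under eq_cvg do rewrite mxE.
apply: cvgM; first exact: cvg_cst.
apply: cvg_det; apply: (mxcvg_mxsub (lift j) id).
exact: (mxcvg_mxsub id (lift i)).
Qed.

Lemma mxcvgV {n : nat} {A : T -> 'M[R]_n} {a : 'M[R]_n} :
  a \in unitmx -> mxcvg F A a -> mxcvg F (fun t => invmx (A t)) (invmx a).
Proof.
move=> ua Aa; have da : \det a != 0 by rewrite -unitfE -unitmxE.
have : mxcvg F (fun t => (\det (A t))^-1 *: \adj (A t)) (invmx a).
  rewrite /invmx ua; apply: mxcvgZ; last exact: mxcvg_adj.
  by apply: cvgV => //; exact: cvg_det.
(* [invmx] leaves a singular matrix unchanged, so Cramer's formula is used only eventually, once the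
   determinant is nonzero. *)
move=> Va i j; apply: cvg_trans (Va i j); apply: near_eq_cvg.
near=> t; rewrite /invmx unitmxE unitfE ifT //; near: t.
exact: cvgr_neq0 (cvg_det Aa) da.
Unshelve. all: by end_near. Qed.

Lemma mxcvg_mxvec {m n : nat} {A : T -> 'M[R]_(m, n)} {a : 'M[R]_(m, n)} :
  mxcvg F A a -> mxcvg F (fun t => mxvec (A t)) (mxvec a).
Proof.
move=> Aa i j; case/mxvec_indexP: j => i1 j1; rewrite (ord1 i) mxvecE.
by under eq_cvg do rewrite mxvecE; exact: Aa.
Qed.

Lemma mxcvg_vec_mx {m n : nat} {A : T -> 'rV[R]_(m * n)} {a : 'rV[R]_(m * n)} :
  mxcvg F A a -> mxcvg F (fun t => vec_mx (A t)) (vec_mx a).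
Proof.
by move=> Aa i j; rewrite mxE; under eq_cvg do rewrite mxE; exact: Aa.
Qed.

Lemma mxcvg_lyapunov_op {n : nat} {A : T -> 'M[R]_n} {a : 'M[R]_n} :
  mxcvg F A a ->
  mxcvg F (fun t => lin_mx (lyapunov_op (A t))) (lin_mx (lyapunov_op a)).
Proof.
move=> Aa i j; rewrite mxE; under eq_cvg do rewrite mxE.
apply: mxcvg_mxvec; apply: mxcvgD.
  exact: mxcvgM Aa (mxcvg_cst _).
exact: mxcvgM (mxcvg_cst _) (mxcvg_tr Aa).
Qed.

Lemma mxcvg_lyapunov_sol {n m : nat} {A : T -> 'M[R]_n} {a : 'M[R]_n}
    (K : 'M[R]_(n, m)) :
  hurwitz a -> (\forall t \near F, hurwitz (A t)) -> mxcvg F A a ->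
  mxcvg F (fun t => lyapunov_sol (A t) K) (lyapunov_sol a K).
Proof.
move=> ha hA Aa i j; rewrite lyapunov_solE //.
set L := vec_mx _.
have LL : mxcvg F (fun t => vec_mx (mxvec (- (K *m K^T)) *m
    invmx (lin_mx (lyapunov_op (A t))))) L.
  apply: mxcvg_vec_mx; apply: mxcvgM; first exact: mxcvg_cst.
  apply: mxcvgV; first exact: lyapunov_op_unitmx.
  exact: mxcvg_lyapunov_op.
apply: cvg_trans (LL i j); apply: near_eq_cvg.
by apply: filterS hA => t hAt; rewrite (lyapunov_solE _ _ hAt).
Qed.

End MatrixLimits.

Lemma mxcvg_id {R : realType} {m n : nat} (F : set_system 'M[R]_(m, n))
    {FF : Filter F} (x : 'M[R]_(m, n)) : F --> x -> mxcvg F id x.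
Proof.
by move=> Fx i j; exact: cvg_trans (cvg_app _ Fx) (@coord_continuous R m n i j x).
Qed.

(** * Independence of sigma from the diagonalizing basis *)

(** The selector [[0 I]]: right multiplication by its transpose deletes the first column, and it is
    also the upper right block of [Jd]. *)
Definition tail_mx (R : pzRingType) (n : nat) : 'M[R]_(n, 1 + n) := row_mx 0 1%:M.

Lemma col'0E {R : pzRingType} {m n : nat} (X : 'M[R]_(m, 1 + n)) :
  col' ord0 X = X *m (tail_mx R n)^T.
Proof.
rewrite -{2}[X]hsubmxK tr_row_mx trmx0 trmx1 mul_row_col mulmx0 mulmx1 add0r.
apply/matrixP => i j; rewrite !mxE; congr (X i _); exact: val_inj.
Qed.

Lemma tail_mxK {R : pzRingType} {n : nat} : tail_mx R n *m (tail_mx R n)^T = 1%:M.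
Proof. by rewrite /tail_mx tr_row_mx mul_row_col mul0mx add0r mul1mx trmx1. Qed.

(** Below its first entry the first column of [Z] vanishes, so the lower left block of [Z] is
    zero. *)
Lemma tail_mx_intertwine {R : comPzRingType} {n : nat} (Z : 'M[R]_(1 + n)) (s : R) :
  col ord0 Z = s *: col ord0 1%:M ->
  tail_mx R n *m Z = drsubmx Z *m tail_mx R n.
Proof.
move=> cZ; rewrite /tail_mx mul_mx_row mulmx0 mulmx1.
rewrite -{1}[Z]submxK /block_mx mul_row_col mul0mx add0r mul1mx.
congr row_mx; apply/matrixP => i j; rewrite !mxE.
have /matrixP/(_ (rshift 1 i) 0) := cZ; rewrite !mxE /= mulr0 => <-.
by congr (Z _ _); apply: val_inj; rewrite /= (ord1 j).
Qed.

Section Conjugation.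
Context {R : realType} {ns nd nE : nat} (N : network R ns nd nE).
Context (U V : 'cV[R]_ns -> 'M[R]_((ns + nd).+1)) (p : 'cV[R]_ns) (s : R).
Hypothesis UU : (U p)^T *m U p = 1%:M.
Hypothesis VV : (V p)^T *m V p = 1%:M.
Hypothesis ss : s * s = 1.
Hypothesis colV : col ord0 (V p) = s *: col ord0 (U p).

Let E := tail_mx R (ns + nd).
(** [Z] passes from the basis [U p] to [V p], and [Z'] is its lower right block. [T] acts by [Z'] on
    the first [ns + nd] state coordinates and by [Z] on the others. *)
Let Z : 'M[R]_(1 + (ns + nd)) := (U p)^T *m V p.
Let Z' := E *m Z *m E^T.
Let T := block_mx Z' 0 0 Z.

Let UUT : U p *m (U p)^T = 1%:M. Proof. exact: mulmx1C. Qed.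
Let VVT : V p *m (V p)^T = 1%:M. Proof. exact: mulmx1C. Qed.
Let UZ : U p *m Z = V p. Proof. by rewrite /Z mulmxA UUT mul1mx. Qed.
Let ZV : Z *m (V p)^T = (U p)^T. Proof. by rewrite /Z -mulmxA VVT mulmx1. Qed.
Let ZZT : Z *m Z^T = 1%:M.
Proof. by rewrite {2}/Z trmx_mul trmxK mulmxA ZV UU. Qed.

Let colZ : col ord0 Z = s *: col ord0 1%:M.
Proof. by rewrite /Z colE -mulmxA -colE colV -scalemxAr colE mulmxA UU -colE. Qed.

(** Since [s * s = 1], the first column of [U p] is also [s] times that of [V p], whose columns are
    orthonormal. Together with [colZ] this makes [Z] block diagonal. *)
Let rowZ : row ord0 Z = s *: row ord0 1%:M.
Proof.
have -> : row ord0 Z = s *: (row ord0 (V p)^T *m V p).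
  rewrite -tr_col colV linearZ /= -scalemxAl scalerA ss scale1r tr_col.
  by rewrite -row_mul.
by rewrite -row_mul VV.
Qed.

Let EZ : E *m Z = Z' *m E.
Proof.
rewrite /Z' (tail_mx_intertwine Z s) // -[_ *m _ *m E^T]mulmxA.
by rewrite tail_mxK mulmx1.
Qed.

Let ZE : Z *m E^T = E^T *m Z'.
Proof.
have rZ : col ord0 Z^T = s *: col ord0 1%:M.
  by rewrite -tr_row rowZ linearZ /= tr_row trmx1.
apply: trmx_inj; rewrite [LHS]trmx_mul [RHS]trmx_mul !trmxK [Z'^T]trmx_mul trmxK.
rewrite [(E *m Z)^T]trmx_mul mulmxA (tail_mx_intertwine Z^T s rZ).
by rewrite -[_ *m _ *m E^T]mulmxA tail_mxK mulmx1.
Qed.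

Let TT : T *m T^T = 1%:M.
Proof.
rewrite /T tr_block_mx !trmx0 mulmx_block !mulmx0 !mul0mx !addr0 add0r ZZT.
suff -> : Z' *m Z'^T = 1%:M by rewrite -scalar_mx_block.
rewrite [Z'^T]trmx_mul trmxK [(E *m Z)^T]trmx_mul !mulmxA -EZ.
by rewrite -[E *m Z *m Z^T]mulmxA ZZT mulmx1 tail_mxK.
Qed.

(** The upper blocks agree by [EZ]. In the lower ones, [ZE] and [UZ] absorb the right factor into
    [V p], and [ZV] extracts [Z] on the left. *)
Let JT : Jd N U p *m T = T *m Jd N V p.
Proof.
rewrite /T /Jd !col'0E.
rewrite (mulmx_block 0 (row_mx 0 1%:M) _ _ Z' 0 0 Z).
rewrite [RHS](mulmx_block Z' 0 0 Z).
rewrite !mulmx0 !mul0mx !addr0 !add0r.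
congr block_mx.
- exact: EZ.
- move: (scaled_laplacian N p) => S.
  rewrite mulNmx mulmxN -[X in - X = _]mulmxA -ZE ![in RHS]mulmxA ZV.
  by rewrite -[in RHS]UZ !mulmxA.
- rewrite mulNmx mulmxN -[X in - X = _]mulmxA UZ.
  by rewrite ![in RHS]mulmxA ZV.
Qed.

Let KT : Kd N U p = T *m Kd N V p.
Proof.
rewrite /Kd /T (mul_block_col Z' 0 0 Z) !mul0mx mulmx0 addr0 add0r.
by rewrite !mulmxA ZV.
Qed.

Let CT : Cd N V p = Cd N U p *m T.
Proof.
rewrite /Cd /T !col'0E (mul_row_block _ 0 Z' 0 0 Z) !mulmx0 mul0mx !addr0.
by rewrite -[in RHS]mulmxA -ZE -[in LHS]UZ !mulmxA.
Qed.

Lemma hurwitz_Jd_basis : hurwitz (Jd N V p) -> hurwitz (Jd N U p).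
Proof. by apply: hurwitz_intertwine JT; have [] := mulmx1_unit TT. Qed.

(** The Lyapunov solution for [U] is that for [V] conjugated by [T], and [CT] absorbs both
    factors. *)
Lemma sigma_basis k : hurwitz (Jd N V p) -> sigma N V k p = sigma N U k p.
Proof.
move=> hJ; rewrite /sigma (lyapunov_sol_conj _ _ _ _ _ TT JT KT hJ) CT.
by rewrite trmx_mul !mulmxA.
Qed.

End Conjugation.

(** * The kernel of the scaled Laplacian *)

Section Network.
Context {R : realType} {ns nd nE : nat} (N : network R ns nd nE).
Local Notation nV := (ns + nd).+1.

(** Absence of loops matters: [incidence] would give a loop the single entry 1 instead of a zero
    column. *)
Lemma incidence_trE (simpleG : simple_graph N) (y : 'cV[R]_nV) k :
  ((incidence N)^T *m y) k 0 = y (src N k) 0 - y (dst N k) 0.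
Proof.
have /negPf sd : dst N k != src N k by rewrite eq_sym; case: simpleG.
rewrite mxE (bigD1 (src N k)) //= (bigD1 (dst N k)) ?sd //= !mxE eqxx sd eqxx.
rewrite mul1r mulN1r big1 ?addr0 // => i /andP[/negPf is_ /negPf id].
by rewrite !mxE is_ id mul0r.
Qed.

Lemma connected_const (y : 'I_nV -> R) : connected_graph N ->
  (forall k, y (src N k) = y (dst N k)) -> forall i j, y i = y j.
Proof.
move=> cG yk i j; case/connectP: (cG i j) => s.
elim: s i => [|x s IH] i /= => [_ -> //|/andP[/existsP[k ik] ps] jl].
rewrite -(IH x) //.
by case/orP: ik => /andP[/eqP <- /eqP <-].
Qed.

Lemma mul_diag_quad (d : 'rV[R]_nE) m (Y : 'M[R]_(nE, m)) i :
  (Y^T *m diag_mx d *m Y) i i = \sum_k d 0 k * Y k i ^+ 2.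
Proof.
rewrite mul_mx_diag mxE; apply: eq_bigr => k _.
by rewrite !mxE mulrAC mulrC expr2.
Qed.

Hypothesis simpleG : simple_graph N.
Hypothesis connectedG : connected_graph N.
Hypothesis M_gt0 : forall i, 0 < diagM N 0 i.
Hypothesis W_gt0 : forall k, 0 < diagW N 0 k.

(** The vanishing corner entry is a sum of squares with positive weights, so [M^{-1/2}] times the
    first column of [V] takes equal values at the ends of every edge. By connectedness it is
    constant. *)
Lemma diagonalizes_col0 (V : 'M[R]_nV) (p : 'cV[R]_ns) :
  (forall k, `|flow N p k| < 1) -> diagonalizes N V p ->
  exists c, forall i, V i ord0 = c * Num.sqrt (diagM N 0 i).
Proof.
move=> fp [_ _]; pose Y := (incidence N)^T *m (Misqrt N *m V).
pose w : 'rV[R]_nE := \row_k (diagW N 0 k * cos (asin (flow N p k))).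
(* For [|x| < 1], [cos (asin x)] is the square root of [1 - x^2], which is positive. *)
have w_gt0 k : 0 < w 0 k.
  rewrite mxE mulr_gt0 //; have := fp k; rewrite ltr_norml => /andP[f1 f2].
  rewrite cos_asin ?ltW //= sqrtr_gt0 subr_gt0.
  by rewrite -real_normK ?num_real // expr_lt1.
have Mt : (Misqrt N)^T = Misqrt N by rewrite /Misqrt /diag_invsqrt tr_diag_mx.
have Ww : Wmx N p = diag_mx w.
  by rewrite /Wmx mul_diag_mx; apply/matrixP => i j; rewrite !mxE mulrnAr.
have -> : V^T *m scaled_laplacian N p *m V = Y^T *m diag_mx w *m Y.
  by rewrite /scaled_laplacian Ww /Y !trmx_mul trmxK Mt !mulmxA.
rewrite mul_diag_quad => /psumr_eq0P Y0.
have {}Y0 k : Y k ord0 = 0.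
  have /eqP : w 0 k * Y k ord0 ^+ 2 = 0.
    by apply: Y0 => // j _; rewrite mulr_ge0 ?sqr_ge0 // ltW.
  by rewrite mulf_eq0 gt_eqF //= sqrf_eq0 => /eqP.
pose y := col ord0 (Misqrt N *m V).
have yk k : y (src N k) 0 = y (dst N k) 0.
  by apply/eqP; rewrite -subr_eq0 -incidence_trE // /y colE mulmxA -colE mxE Y0.
exists (y ord0 0) => i; rewrite (connected_const (y ^~ 0) connectedG yk ord0 i).
rewrite /y mxE /Misqrt /diag_invsqrt mul_diag_mx !mxE mulrAC mulVf ?mul1r //.
by rewrite gt_eqF // sqrtr_gt0.
Qed.

(** Both columns are multiples of [M^{1/2} 1] of norm one, so the coefficients [a] and [b] have
    equal squares and [b / a] is a sign. *)
Lemma diagonalizes_col0_proportional (U V : 'M[R]_nV) (p q : 'cV[R]_ns) :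
  (forall k, `|flow N p k| < 1) -> (forall k, `|flow N q k| < 1) ->
  diagonalizes N U p -> diagonalizes N V q ->
  exists2 s, s * s = 1 & col ord0 V = s *: col ord0 U.
Proof.
move=> fp fq dU dV; have [a Ua] := diagonalizes_col0 U p fp dU.
have [b Vb] := diagonalizes_col0 V q fq dV.
have norm1 (X : 'M[R]_nV) c : X^T *m X = 1%:M ->
    (forall i, X i ord0 = c * Num.sqrt (diagM N 0 i)) ->
    c ^+ 2 * \sum_i diagM N 0 i = 1.
  move=> /matrixP/(_ ord0 ord0); rewrite !mxE /= mulr1n => <- Xc.
  rewrite mulr_sumr; apply: eq_bigr => i _.
  by rewrite mxE Xc mulrACA -!expr2 sqr_sqrtr // ltW.
have a1 := norm1 U a (let: And3 h _ _ := dU in h) Ua.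
have b1 := norm1 V b (let: And3 h _ _ := dV in h) Vb.
have S0 : \sum_i diagM N 0 i != 0.
  by apply: contra_eq_neq a1 => ->; rewrite mulr0 eq_sym oner_eq0.
have a0 : a != 0.
  by apply: contra_eq_neq a1 => ->; rewrite expr0n mul0r eq_sym oner_eq0.
have ab : b ^+ 2 = a ^+ 2 by apply: (mulIf S0); rewrite a1.
exists (b / a).
  by rewrite mulrACA -invfM -!expr2 ab divff // expf_neq0.
by apply/matrixP => i j; rewrite !mxE Ua Vb mulrA divfK.
Qed.

End Network.

(** * The domain and the objective *)

Section Domain.
Context {R : realType} {ns nd nE : nat} (N : network R ns nd nE).

Lemma Pplus_pmax : (forall i, 0 <= pmax N i 0) -> psum N <= \sum_i pmax N i 0 ->
  Pplus N (b2 N).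
Proof.
move=> pmax_ge0 psum_le; split=> [i|i|i] //; rewrite ?mxE //.
rewrite lerBlDr (le_trans psum_le) // [leLHS](bigID (fun j : 'I_ns.+1 => (i < j)%N)).
rewrite /= addrC lerD2r.
under [leRHS]eq_bigr do rewrite !mxE.
(* The slack index [ns] exceeds [i], so its term drops out and both sums range over ['I_ns]. *)
rewrite big_mkcond big_ord_recr /= [(i < ns)%N]ltn_ord addr0.
by apply: ler_sum => j _; rewrite -leqNgt; case: ifP; rewrite (mul1r, mul0r).
Qed.

(** Stated for row vectors, to which [rV_compact] applies: the domain is a product of segments cut
    by closed half-spaces. *)
Lemma compact_Pplus_tr : compact [set v : 'rV[R]_ns | Pplus N v^T].
Proof.
pose box := [set v : 'rV[R]_ns | forall i, `[0, b2 N i 0]%classic (v ord0 i)].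
pose half i := [set v : 'rV[R]_ns | b1 N i 0 <= (A1 R ns *m v^T) i 0].
suff -> : [set v : 'rV[R]_ns | Pplus N v^T] = box `&` \bigcap_i half i.
  apply: compact_closedI.
    apply: (@rV_compact R ns (fun i => `[0, b2 N i 0]%classic)) => i.
    exact: segment_compact.
  apply: closed_bigI => i _.
  apply: (@closed_comp _ _ (fun v : 'rV[R]_ns => (A1 R ns *m v^T) i 0)
    [set y | b1 N i 0 <= y]); last exact: closed_ge.
  move=> v _; have vv : mxcvg (nbhs v) id v by exact: mxcvg_id.
  exact: mxcvgM (mxcvg_cst _ _) (mxcvg_tr _ vv) i 0.
apply/seteqP; split => v /=.
  move=> [v0 vA vb]; split=> [i|i _]; last exact: vA.
  rewrite /box /= in_itv /=; apply/andP.
  by split; [have := v0 i | have := vb i]; rewrite mxE.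
move=> [vbox vA]; split=> [i|i|i]; last 2 first.
- exact: vA.
- by have := vbox i; rewrite /= in_itv /= [_^T _ _]mxE => /andP[].
- by have := vbox i; rewrite /= in_itv /= [_^T _ _]mxE => /andP[].
Qed.

End Domain.

(** * Continuity of the objective for a constant basis *)

Section Continuity.
Context {R : realType} {ns nd nE : nat} (N : network R ns nd nE).
Context (V : 'M[R]_((ns + nd).+1)).
Context {T : Type} (F : set_system T) {FF : Filter F}.
Context (P : T -> 'cV[R]_ns) (p : 'cV[R]_ns).
Hypothesis Pp : mxcvg F P p.
Hypothesis flow_lt1 : forall k, `|flow N p k| < 1.

Lemma cvg_flow k : flow N (P t) k @[t --> F] --> flow N p k.
Proof. exact: mxcvgD (mxcvgM _ (mxcvg_cst _ _) Pp) (mxcvg_cst _ _) k 0. Qed.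

(** The bound on the flows keeps the argument of [asin] in the open interval where it is
    continuous. *)
Lemma mxcvg_scaled_laplacian :
  mxcvg F (fun t => scaled_laplacian N (P t)) (scaled_laplacian N p).
Proof.
apply: mxcvgM (mxcvg_cst _ _); apply: mxcvgM (mxcvg_cst _ _).
apply: mxcvgM; first exact: mxcvg_cst.
apply: mxcvgM; first exact: mxcvg_cst.
apply: mxcvg_diag_mx => i k; rewrite mxE; under eq_cvg do rewrite mxE.
apply: continuous_cvg; first exact: continuous_cos.
apply: continuous_cvg; last exact: cvg_flow.
by apply: continuous_asin; rewrite -ltr_norml.
Qed.

Lemma mxcvg_Jd :
  mxcvg F (fun t => Jd N (fun=> V) (P t)) (Jd N (fun=> V) p).
Proof.
apply: mxcvg_block; [exact: mxcvg_cst|exact: mxcvg_cst| |exact: mxcvg_cst].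
apply: mxcvgN; apply: (mxcvg_mxsub _ id (lift ord0)).
apply: mxcvgM (mxcvg_cst _ _); apply: mxcvgM (mxcvg_cst _ _) _.
exact: mxcvg_scaled_laplacian.
Qed.

Hypothesis hurwitz_p : hurwitz (Jd N (fun=> V) p).
Hypothesis hurwitz_P : \forall t \near F, hurwitz (Jd N (fun=> V) (P t)).

Lemma cvg_sigma k : sigma N (fun=> V) k (P t) @[t --> F] --> sigma N (fun=> V) k p.
Proof.
have CQC : mxcvg F (fun t => Cd N (fun=> V) (P t) *m
    lyapunov_sol (Jd N (fun=> V) (P t)) (Kd N (fun=> V) (P t)) *m
    (Cd N (fun=> V) (P t))^T) (Cd N (fun=> V) p *m
    lyapunov_sol (Jd N (fun=> V) p) (Kd N (fun=> V) p) *m (Cd N (fun=> V) p)^T).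
  apply: mxcvgM (mxcvg_cst _ _); apply: mxcvgM (mxcvg_cst _ _) _.
  exact: mxcvg_lyapunov_sol mxcvg_Jd.
apply: cvg_comp (CQC k k) _.
exact: sqrt_continuous.
Qed.

Lemma cvg_f_obj r :
  f_obj N (fun=> V) r (P t) @[t --> F] --> f_obj N (fun=> V) r p.
Proof.
apply: cvg_big => [|k _]; first exact: max_continuous.
apply: cvgD; last by apply: cvgM; [exact: cvg_cst | exact: cvg_sigma].
apply: cvg_comp (cvg_norm (cvg_flow k)) _.
by apply: continuous_asin; rewrite flow_lt1 (lt_le_trans _ (normr_ge0 _)) ?ltrN10.
Qed.

End Continuity.

Theorem theorem3p1 (R : realType) (ns nd nE : nat) (N : network R ns nd nE)
    (r : R) (U : 'cV[R]_ns -> 'M[R]_((ns + nd).+1))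
    (supply_ge2 : (2 <= ns.+1)%N)
    (simpleG : simple_graph N)
    (connectedG : connected_graph N)
    (M_gt0 : forall i, 0 < diagM N 0 i)
    (D_ge0 : forall i, 0 <= diagD N 0 i)
    (K2_ge0 : forall i, 0 <= diagK2 N 0 i)
    (W_gt0 : forall k, 0 < diagW N 0 k)
    (pmax_ge0 : forall i, 0 <= pmax N i 0)
    (pdem_ge0 : forall j, 0 <= pdem N j 0)
    (psum_gt0 : 0 < psum N)
    (psum_le : psum N <= \sum_i pmax N i 0)
    (r_gt0 : 0 < r)
    (flow_lt1 : forall p, Pplus N p -> forall k, `|flow N p k| < 1)
    (U_diag : forall p, Pplus N p -> diagonalizes N (U p) p)
    (Jd_hurwitz : forall p, Pplus N p -> hurwitz (Jd N U p))
    (sigma_gt0 : forall p, Pplus N p -> forall k, 0 < sigma N U k p) :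
  exists2 p, Pplus N p & f_obj N U r p = inf [set f_obj N U r q | q in Pplus N].
Proof.
have P0 : Pplus N (b2 N) by exact: Pplus_pmax.
(* The basis is frozen at the point [b2 N], already known to lie in the domain. *)
pose V := U (b2 N).
have basis p : Pplus N p -> exists2 s, s * s = 1 & col ord0 (U p) = s *: col ord0 V.
  move=> Pp; apply: (diagonalizes_col0_proportional N) (U_diag _ P0) (U_diag _ Pp) => //.
  - exact: flow_lt1.
  - exact: flow_lt1.
have orthU p : Pplus N p -> (U p)^T *m U p = 1%:M by move=> /U_diag[].
have hurwitzV p : Pplus N p -> hurwitz (Jd N (fun=> V) p).
  move=> Pp; have [s ss sV] := basis p Pp.
  exact: hurwitz_Jd_basis (orthU _ P0) (orthU _ Pp) ss sV (Jd_hurwitz _ Pp).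
have f_objV p : Pplus N p -> f_obj N U r p = f_obj N (fun=> V) r p.
  move=> Pp; have [s ss sV] := basis p Pp.
  apply: eq_bigr => k _; congr (_ + _ * _).
  exact: sigma_basis (orthU _ P0) (orthU _ Pp) ss sV k (Jd_hurwitz _ Pp).
pose A := [set v : 'rV[R]_ns | Pplus N v^T].
have [||v /set_mem Av min_v] := @compact_EVT_min _ _
    (fun v : 'rV[R]_ns => f_obj N (fun=> V) r v^T) A _ (compact_Pplus_tr N).
- by exists (b2 N)^T; rewrite /A /= trmxK.
- apply/subspace_continuousP => v Av; apply: cvg_f_obj.
  + apply: mxcvg_tr; apply: mxcvg_id; exact: cvg_within.
  + exact: flow_lt1.
  + exact: hurwitzV.
  (* Hurwitz stability is known only on the domain; the filter [within A] supplies membership. *)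
  + by apply: filterS (withinT A _) => w; exact: hurwitzV.
have min_f q : Pplus N q -> f_obj N U r v^T <= f_obj N U r q.
  move=> Pq; rewrite (f_objV _ Av) (f_objV _ Pq) -[q]trmxK.
  by apply: min_v; rewrite inE /A /= trmxK.
exists v^T => //; apply/esym/le_anti/andP; split.
  apply: ge_inf; last by exists v^T.
  by exists (f_obj N U r v^T) => _ [q Pq <-]; exact: min_f.
apply: lb_le_inf; first by exists (f_obj N U r v^T), v^T.
by move=> _ [q Pq <-]; exact: min_f.
Qed.
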